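(* Let $N$ be a Hom-Nijenhuis operator of an $n$-Hom-Lie algebra $(\mathfrak g,[\cdot,\cdots,\cdot]_{\mathfrak g},\alpha)$. Put $$\omega_i(x_1,\ldots,x_n)=[x_1,\ldots,x_n]_N^{i},\qquad 1\le i\le n-1.$$ Then $\omega_1,\ldots,\omega_{n-1}$ generate an $(n-1)$-order $1$-parameter deformation of $(\mathfrak g,[\cdot,\cdots,\cdot]_{\mathfrak g},\alpha)$. Moreover, this deformation is trivial.
   Context: All vector spaces are over an algebraically closed field $\mathbb K$ of characteristic $0$; $n\ge2$ is an integer. An $n$-Hom-Lie algebra $(\mathfrak g,[\cdot,\cdots,\cdot]_{\mathfrak g},\alpha)$ is a vector space $\mathfrak g$ with a linear map $[\cdot,\cdots,\cdot]_{\mathfrak g}:\wedge^n\mathfrak g\to\mathfrak g$ and an algebra automorphism $\alpha:\mathfrak g\to\mathfrak g$ (a linear bijection with $\alpha[x_1,\ldots,x_n]_{\mathfrak g}=[\alpha(x_1),\ldots,\alpha(x_n)]_{\mathfrak g}$) such that for all $x_1,\ldots,x_{n-1},y_1,\ldots,y_n\in\mathfrak g$ $$[\alpha(x_1),\ldots,\alpha(x_{n-1}),[y_1,\ldots,y_n]_{\mathfrak g}]_{\mathfrak g}=\sum_{i=1}^n[\alpha(y_1),\ldots,\alpha(y_{i-1}),[x_1,\ldots,x_{n-1},y_i]_{\mathfrak g},\alpha(y_{i+1}),\ldots,\alpha(y_n)]_{\mathfrak g}.$$ Deformations: put $\omega_0=[\cdot,\cdots,\cdot]_{\mathfrak g}$.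 Skew-symmetric multilinear maps $\omega_1,\ldots,\omega_{n-1}:\wedge^n\mathfrak g\to\mathfrak g$ generate an $(n-1)$-order $1$-parameter deformation of $(\mathfrak g,\omega_0,\alpha)$ if for every $\lambda\in\mathbb K$, $(\mathfrak g,[\cdot,\cdots,\cdot]_\lambda,\alpha)$ is an $n$-Hom-Lie algebra, where $[x_1,\ldots,x_n]_\lambda=\sum_{i=0}^{n-1}\lambda^i\omega_i(x_1,\ldots,x_n)$. The deformation is trivial if there exists a linear map $N:\mathfrak g\to\mathfrak g$ such that for all $\lambda\in\mathbb K$ the map $T_\lambda=\alpha+\lambda N$ satisfies $T_\lambda\circ\alpha=\alpha\circ T_\lambda$ and $T_\lambda[x_1,\ldots,x_n]_\lambda=[T_\lambda x_1,\ldots,T_\lambda x_n]_{\mathfrak g}$ for all $x_1,\ldots,x_n\in\mathfrak g$. Brackets attached to a linear map $N:\mathfrak g\to\mathfrak g$: $$[x_1,\ldots,x_n]_N^{1}=\sum_{i=1}^n[x_1,\ldots,N\alpha^{-1}(x_i),\ldots,x_n]_{\mathfrak g}-N[\alpha^{-1}(x_1),\ldots,\alpha^{-1}(x_n)]_{\mathfrak g},$$ and inductively for $2\le i\le n-1$ $$[x_1,\ldots,x_n]_N^{i}=\sum_{l_1<l_2<\cdots<l_i}[x_1,\ldots,N\alpha^{-1}(x_{l_1}),\ldots,N\alpha^{-1}(x_{l_2}),\ldots,N\alpha^{-1}(x_{l_i}),\ldots,x_n]_{\mathfrak g}-N[\alpha^{-1}(x_1),\ldots,\alpha^{-1}(x_n)]_N^{i-1},$$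 where in each summand the entries in positions $l_1,\ldots,l_i$ are replaced by $N\alpha^{-1}(x_{l_j})$ and the other entries $x_k$ are unchanged. A linear map $N:\mathfrak g\to\mathfrak g$ is a Hom-Nijenhuis operator if $N\circ\alpha=\alpha\circ N$ and $[Nx_1,\ldots,Nx_n]_{\mathfrak g}=N\big([x_1,\ldots,x_n]_N^{n-1}\big)$ for all $x_1,\ldots,x_n\in\mathfrak g$. *)

(* Defs.v *)
From mathcomp Require Import all_boot all_fingroup all_algebra.
Set Implicit Arguments.
Unset Strict Implicit.
Unset Printing Implicit Defensive.
Import GRing.Theory.
Local Open Scope ring_scope.

(* A linear bijection, carried together with its (unique) inverse map. *)
Record linear_bij (K : fieldType) (V : lmodType K) := LinearBij {
  lbij :> {linear V -> V};
  lbijV : V -> V;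
  lbijK : cancel lbij lbijV;
  lbijVK : cancel lbijV lbij }.

Section NHomLie.
Variables (K : fieldType) (V : lmodType K) (n : nat).

Definition args := {ffun 'I_n -> V}.
Definition nary := args -> V.

Definition set_arg (x : args) (i : 'I_n) (z : V) : args :=
  [ffun j => if j == i then z else x j].

(* (x_1, ..., x_{n-1}, z): the index i is sent to x_i when i < n.-1, and the
   last index to z. *)
Definition rcons_args (x : {ffun 'I_n.-1 -> V}) (z : V) : args :=
  [ffun i : 'I_n => oapp x z (insub (val i))].

Definition map_args (f : V -> V) (x : args) : args := [ffun i => f (x i)].

Definition multilinear (w : nary) : Prop :=
  forall (x : args) (i : 'I_n) (a : K) (u v : V),
    w (set_arg x i (a *: u + v)) =
      a *: w (set_arg x i u) + w (set_arg x i v).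

Definition skew_symmetric (w : nary) : Prop :=
  forall (s : 'S_n) (x : args), w [ffun i => x (s i)] = (-1) ^+ s *: w x.

(* In characteristic 0 these are exactly the linear maps from the n-th exterior
   power of V to V. *)
Definition skew_multilinear (w : nary) : Prop :=
  multilinear w /\ skew_symmetric w.

Definition fundamental_identity (alpha : V -> V) (br : nary) : Prop :=
  forall (x : {ffun 'I_n.-1 -> V}) (y : args),
    br (rcons_args [ffun i => alpha (x i)] (br y)) =
      \sum_(i < n) br (set_arg (map_args alpha y) i (br (rcons_args x (y i)))).

Record n_hom_lie (br : nary) (alpha : linear_bij V) : Prop := NHomLie {
  nhl_skew : skew_multilinear br;
  nhl_morph : forall x : args, alpha (br x) = br (map_args alpha x);
  nhl_fundamental : fundamental_identity alpha br }.

Section Deformation.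
Variables (br : nary) (alpha : linear_bij V).

(* A family omega_1, ..., omega_{n-1} is given as a function on nat whose values
   outside [1, n-1] are ignored; index 0 is always the original bracket. *)
Definition deformed (omega : nat -> nary) (lam : K) : nary := fun x =>
  \sum_(i < n) lam ^+ i *: (if val i == 0%N then br x else omega i x).

Definition generates_deformation (omega : nat -> nary) : Prop :=
  (forall i : nat, (0 < i < n)%N -> skew_multilinear (omega i)) /\
  (forall lam : K, n_hom_lie (deformed omega lam) alpha).

Definition trivial_deformation (omega : nat -> nary) : Prop :=
  exists N : {linear V -> V}, forall lam : K,
    let T := fun x : V => alpha x + lam *: N x in
    T \o alpha =1 alpha \o T /\
    (forall x : args, T (deformed omega lam x) = br (map_args T x)).

(* The sum over l_1 < ... < l_i is indexed by the i-element sets L of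
   positions. The recursion starts from the original bracket, so that
   nijenhuis_bracket N 1 is the usual first-order bracket. *)
Fixpoint nijenhuis_bracket (N : V -> V) (i : nat) : nary :=
  if i is i'.+1 then fun x =>
    \sum_(L : {set 'I_n} | #|L| == i)
       br [ffun k => if k \in L then N (lbijV alpha (x k)) else x k]
    - N (nijenhuis_bracket N i' (map_args (lbijV alpha) x))
  else br.

Definition hom_nijenhuis (N : {linear V -> V}) : Prop :=
  N \o alpha =1 alpha \o N /\
  (forall x : args, br (map_args N x) = N (nijenhuis_bracket N n.-1 x)).

End Deformation.
End NHomLie.

(* Main.v *)
(** Put T = alpha + lam N.  Expanding br (T x) over the set
    L of positions where N is selected, and collecting the terms with #|L| = i,
    the recursion defining the brackets telescopes; the Nijenhuis condition
    absorbs the term of degree n, so that T [x]_lam = br (T x).  Hence T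
    maps the defect of the fundamental identity of [.]_lam to the (zero) defect
    of the one of br.  T need not be injective for a given lam, but the defect is
    a polynomial in lam with coefficients in V, and alpha + lam N is injective on
    V[lam] because alpha is injective on V. *)
Require Import Defs.
From mathcomp Require Import all_boot all_fingroup all_algebra.
Set Implicit Arguments.
Unset Strict Implicit.
Unset Printing Implicit Defensive.
Import GRing.Theory.
Local Open Scope ring_scope.

(** * Polynomials in [lam] with coefficients in a vector space *)

Section VectorPolynomials.
Variables (K : fieldType) (V : lmodType K).

(** Terms of equal total degree [i + j] are merged, with [d] independent of [lam]. The bound [m + p]
    is not sharp; surplus coefficients are zero. *)
Lemma sum_exp_double (m p : nat) (c : nat -> nat -> V) :
  exists d : nat -> V, forall lam : K,
    \sum_(i < m) \sum_(j < p) lam ^+ (i + j) *: c i j =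
    \sum_(k < m + p) lam ^+ k *: d k.
Proof.
exists (fun k => \sum_(i < m) \sum_(j < p) (if (i + j)%N == k then c i j else 0)).
move=> lam; under [RHS]eq_bigr do rewrite scaler_sumr.
rewrite [RHS]exchange_big; apply: eq_bigr => i _.
under [RHS]eq_bigr do rewrite scaler_sumr.
rewrite [RHS]exchange_big; apply: eq_bigr => j _ /=.
have lt_ij : (i + j < m + p)%N.
  by rewrite (leq_trans (n := i + p)%N) ?ltn_add2l ?leq_add2r // ltnW.
rewrite (bigD1 (Ordinal lt_ij)) //= eqxx big1 ?addr0 // => k neq_k.
case: eqP => [e|_]; last by rewrite scaler0.
by case/eqP: neq_k; apply: val_inj.
Qed.

(** For [k <= m], this is the coefficient of [lam ^+ k] when [f + lam g] is applied to the
    polynomial with coefficients [d 0, ..., d (m - 1)]. *)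
Definition pencil_coef (f g : V -> V) (m : nat) (d : nat -> V) (k : nat) : V :=
  (if (k < m)%N then f (d k) else 0) + (if k is k'.+1 then g (d k') else 0).

Lemma pencil_sum (f g : {linear V -> V}) (m : nat) (d : nat -> V) (lam : K) :
  f (\sum_(k < m) lam ^+ k *: d k) + lam *: g (\sum_(k < m) lam ^+ k *: d k) =
  \sum_(k < m.+1) lam ^+ k *: pencil_coef f g m d k.
Proof.
under [RHS]eq_bigr do rewrite scalerDr.
(* The [f] part has a zero term in degree [m], the [g] part one in degree 0. *)
rewrite big_split /= [X in _ = X + _]big_ord_recr /= ltnn scaler0 addr0.
congr (_ + _).
  by rewrite linear_sum; apply: eq_bigr => i _; rewrite ltn_ord linearZ.
rewrite big_ord_recl /= scaler0 add0r linear_sum scaler_sumr.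
by apply: eq_bigr => i _; rewrite linearZ /= scalerA exprS.
Qed.

Hypothesis charK : [pchar K] =i pred0.

(* f (2 lam) - 2^m f lam has no term of degree m, which lowers the degree. *)
Lemma sum_exp_eq0 (m : nat) (d : nat -> V) :
  (forall lam : K, \sum_(k < m) lam ^+ k *: d k = 0) ->
  forall k, (k < m)%N -> d k = 0.
Proof.
have inj2 (i j : nat) : (i < j)%N -> (2 ^+ i - 2 ^+ j : K) != 0.
  (* Up to sign this is the image in [K] of a positive natural number, nonzero in characteristic
     0. *)
  move=> lt_ij; rewrite -opprB oppr_eq0 -!natrX -natrB ?leq_exp2l ?(ltnW lt_ij) //.
  by rewrite (iffLR (pcharf0P _) charK) -lt0n subn_gt0 ltn_exp2l.
elim: m d => [//|m IHm] d f0.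
have lt_m k : (k < m)%N -> d k = 0.
  move=> lt_km.
  have : (2 ^+ k - 2 ^+ m : K) *: d k = 0.
    apply: (IHm (fun k => (2 ^+ k - 2 ^+ m) *: d k)) => // lam.
    have f_eq0 : \sum_(k < m.+1) (2 * lam) ^+ k *: d k -
        2 ^+ m *: \sum_(k < m.+1) lam ^+ k *: d k = 0.
      by rewrite !f0 scaler0 subr0.
    rewrite -[RHS]f_eq0.
    rewrite scaler_sumr -sumrB big_ord_recr /= exprMn scalerA subrr addr0.
    apply: eq_bigr => i _; rewrite !scalerA -scalerBl exprMn mulrBr.
    by congr ((_ - _) *: _); rewrite mulrC.
  by move/eqP; rewrite scaler_eq0 (negPf (inj2 _ _ lt_km)) => /eqP.
move=> k; rewrite ltnS leq_eqVlt => /predU1P[->|/lt_m//].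
(* With the lower coefficients gone, the value at [lam = 1] is the top one. *)
have := f0 1; rewrite big_ord_recr /= big1 ?add0r ?expr1n ?scale1r // => i _.
by rewrite lt_m ?scaler0.
Qed.

(** Degree 0 gives [f (d 0) = 0], and degree [k.+1] gives [f (d k.+1) + g (d k) = 0], so the
    coefficients vanish one after the other from the lowest degree up. *)
Lemma pencil_inj (f g : {linear V -> V}) (m : nat) (d : nat -> V) :
  injective f ->
  (forall lam : K, f (\sum_(k < m) lam ^+ k *: d k) +
             lam *: g (\sum_(k < m) lam ^+ k *: d k) = 0) ->
  forall k, (k < m)%N -> d k = 0.
Proof.
move=> f_inj fg0.
have e0 : forall k, (k < m.+1)%N -> pencil_coef f g m d k = 0.
  by apply: sum_exp_eq0 => lam; rewrite -pencil_sum.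
elim=> [|k IHk] lt_km; apply: f_inj; rewrite linear0.
  by have := e0 0%N (ltn0Sn _); rewrite /pencil_coef lt_km addr0.
by have := e0 k.+1 (ltnW lt_km); rewrite /pencil_coef lt_km IHk 1?ltnW // linear0 addr0.
Qed.

End VectorPolynomials.

(** * Expansion of multilinear maps *)

Section Multilinear.
Variables (K : fieldType) (V : lmodType K) (n : nat).
Implicit Types (w : nary V n) (x y : args V n).

Lemma set_arg_map (f : V -> V) x i z :
  map_args f (set_arg x i z) = set_arg (map_args f x) i (f z).
Proof. by apply/ffunP => k; rewrite !ffunE; case: eqP. Qed.

Lemma rcons_args_map (f : V -> V) (x : {ffun 'I_n.-1 -> V}) z :
  map_args f (rcons_args x z) = rcons_args [ffun i => f (x i)] (f z).
Proof. by apply/ffunP => k; rewrite !ffunE; case: insub => //= i; rewrite ffunE. Qed.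

(** Presents the appended last entry as an ordinary slot, so that multilinearity applies to it. *)
Lemma rcons_args_set (x : {ffun 'I_n.-1 -> V}) : (0 < n)%N ->
  exists i : 'I_n, forall z, rcons_args x z = set_arg (rcons_args x 0) i z.
Proof.
move=> n_gt0; have lt_n : (n.-1 < n)%N by rewrite prednK.
exists (Ordinal lt_n) => z; apply/ffunP => k; rewrite !ffunE.
case: eqP => [-> | neq_k]; first by rewrite insubF //= ltnn.
case: insubP => //= /negP[]; rewrite ltn_neqAle -ltnS prednK // ltn_ord andbT.
by apply/eqP => e; apply: neq_k; apply: val_inj.
Qed.

Lemma multilinear_sum w (I : finType) (c : I -> K) (v : I -> V) x i :
  multilinear w ->
  w (set_arg x i (\sum_j c j *: v j)) = \sum_j c j *: w (set_arg x i (v j)).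
Proof.
move=> w_lin; elim/big_rec2: _ => [|j u1 u2 _ <-]; last exact: w_lin.
(* Empty sum: the instance [a = -1], [u = v = 0] shows that [w] vanishes when a slot is 0. *)
by have := w_lin x i (-1) 0 0; rewrite scaler0 addr0 scaleN1r addNr.
Qed.

Lemma multilinear_rcons_sum w (I : finType) (c : I -> K) (v : I -> V)
    (x : {ffun 'I_n.-1 -> V}) : (0 < n)%N -> multilinear w ->
  w (rcons_args x (\sum_j c j *: v j)) = \sum_j c j *: w (rcons_args x (v j)).
Proof.
move=> n_gt0 w_lin; have [i xE] := rcons_args_set x n_gt0.
by rewrite xE multilinear_sum //; apply: eq_bigr => j _; rewrite -xE.
Qed.

(** Restricting the perturbed positions to a set [A] allows induction on its size: linearity in one
    slot [i] of [A] leaves two terms perturbed on [A :\ i]. *)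
Lemma multilinear_expand_sub w x y (lam : K) (A : {set 'I_n}) :
  multilinear w ->
  w [ffun k => if k \in A then x k + lam *: y k else x k] =
  \sum_(L : {set 'I_n} | L \subset A)
     lam ^+ #|L| *: w [ffun k => if k \in L then y k else x k].
Proof.
move=> w_lin.
have [m leAm] := ubnP #|A|; elim: m => // m IHm in A x leAm *.
have [-> | [i Ai]] := set_0Vmem A.
  rewrite (big_pred1 set0) => [|L]; last by rewrite subset0.
  by rewrite cards0 scale1r; congr w; apply/ffunP => k; rewrite !ffunE inE.
have {leAm} ltAm : (#|A :\ i| < m)%N by rewrite (cardsD1 i A) Ai in leAm.
pose z := [ffun k => if k \in A :\ i then x k + lam *: y k else x k] : args V n.
have -> : [ffun k => if k \in A then x k + lam *: y k else x k] =
    set_arg z i (lam *: y i + x i).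
  apply/ffunP => k; rewrite !ffunE !inE.
  by have [->|] := eqVneq k i; rewrite ?Ai //= addrC.
(* Sets [L] avoiding [i] come from the summand [x i], the others from [lam *: y i]. *)
rewrite w_lin addrC (bigID (fun L : {set _} => i \notin L)) /=; congr (_ + _).
  have -> : set_arg z i (x i) =
      [ffun k => if k \in A :\ i then x k + lam *: y k else x k].
    by apply/ffunP => k; rewrite !ffunE !inE; have [->|] := eqVneq k i.
  by rewrite IHm //; apply: eq_bigl => L; rewrite subsetD1.
(* The induction hypothesis is used at the base point [x] with [y i] written in slot [i]. *)
have -> : set_arg z i (y i) = [ffun k => if k \in A :\ i
    then (set_arg x i (y i)) k + lam *: y k else (set_arg x i (y i)) k].
  by apply/ffunP => k; rewrite !ffunE !inE; have [->|] := eqVneq k i.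
(* Adding [i] to [L] raises its size by one, which absorbs the extra factor [lam]. *)
rewrite IHm // scaler_sumr [RHS](reindex_onto (fun L => i |: L) (fun L => L :\ i)) /=.
  apply: eq_big => [L|L].
    rewrite subUset sub1set Ai !inE eqxx /= andbT subsetD1.
    have [Li|Li] := boolP (i \in L); last by rewrite setU1K // eqxx !andbT.
    rewrite !andbF; apply/esym/negbTE/negP => /andP[_ /eqP e].
    by move: Li; rewrite -e !inE eqxx.
  rewrite subsetD1 => /andP[_ Li]; rewrite scalerA cardsU1 Li exprS.
  congr (_ *: w _); apply/ffunP => k; rewrite !ffunE !inE.
  by have [->|] := eqVneq k i; rewrite ?(negPf Li).
by move=> L /andP[_ /negPn Li]; rewrite setD1K.
Qed.

Lemma multilinear_expand w x y (lam : K) : multilinear w ->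
  w [ffun k => x k + lam *: y k] =
  \sum_(i < n.+1) lam ^+ i *: \sum_(L : {set 'I_n} | #|L| == i)
     w [ffun k => if k \in L then y k else x k].
Proof.
move=> w_lin; have := multilinear_expand_sub x y lam setT w_lin.
have -> : [ffun k => if k \in [set: 'I_n] then x k + lam *: y k else x k] =
    [ffun k => x k + lam *: y k] by apply/ffunP => k; rewrite !ffunE inE.
move->; have lt_card (L : {set 'I_n}) : (#|L| < n.+1)%N.
  by rewrite ltnS -[X in (_ <= X)%N]card_ord max_card.
rewrite (partition_big (fun L => Ordinal (lt_card L)) predT) //=.
apply: eq_bigr => i _; rewrite scaler_sumr.
by apply: eq_big => [L|L /andP[_ /eqP <-]]; rewrite ?subsetT.
Qed.

End Multilinear.

(** * Skew-symmetry, multilinearity and [alpha]-equivariance of the Nijenhuis brackets *)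

Section Nijenhuis.
Variables (K : fieldType) (V : lmodType K) (n : nat).
Variables (br : nary V n) (alpha : linear_bij V) (N : {linear V -> V}).
Hypothesis g_nhl : n_hom_lie br alpha.
Hypothesis N_alpha : N \o alpha =1 alpha \o N.

Notation nb := (nijenhuis_bracket br alpha N).
Notation alphaV := (lbijV alpha).

Lemma lbijV_linear : linear alphaV.
Proof.
by move=> a u v; apply: (can_inj (@lbijK _ _ alpha)); rewrite linearP !lbijVK.
Qed.

Lemma lbijV_comm x : N (alphaV (alpha x)) = alpha (N (alphaV x)).
Proof. by rewrite lbijK -[RHS]N_alpha /= lbijVK. Qed.

Lemma nijenhuis_bracket_multilinear i : multilinear (nb i).
Proof.
have [br_lin _] := nhl_skew g_nhl.
elim: i => [|i IHi] // x k a u v; rewrite /=.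
rewrite !set_arg_map lbijV_linear IHi linearP scalerBr addrACA -opprD.
congr (_ - _); rewrite scaler_sumr -big_split; apply: eq_bigr => L _ /=.
have setE z : [ffun j => if j \in L then N (alphaV (set_arg x k z j))
                         else set_arg x k z j] =
    set_arg [ffun j => if j \in L then N (alphaV (x j)) else x j] k
      (if k \in L then N (alphaV z) else z).
  by apply/ffunP => j; rewrite !ffunE; have [->|] := eqVneq j k.
by rewrite !setE; case: ifP => _; rewrite ?lbijV_linear ?linearP br_lin.
Qed.

Lemma nijenhuis_bracket_skew i : skew_symmetric (nb i).
Proof.
have [_ br_skew] := nhl_skew g_nhl.
elim: i => [|i IHi] // s x; rewrite /= scalerBr; congr (_ - _).
  (* Permuting the arguments by [s] replaces the set of selected positions by its preimage under
     [s]. *)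
  rewrite scaler_sumr (reindex_inj (@imset_inj _ _ (s^-1)%g perm_inj)) /=.
  apply: eq_big => [L|L _]; first by rewrite card_imset //; apply: perm_inj.
  rewrite -br_skew; congr br; apply/ffunP => k; rewrite !ffunE.
  by rewrite -{1}[k](permK s) mem_imset //; apply: perm_inj.
rewrite -linearZ -IHi; congr (N (nb _ _)); apply/ffunP => k.
by rewrite !ffunE.
Qed.

Lemma nijenhuis_bracket_morph i x : alpha (nb i x) = nb i (map_args alpha x).
Proof.
elim: i x => [|i IHi] x /=; first exact: nhl_morph.
rewrite linearB linear_sum /=; congr (_ - _).
  apply: eq_bigr => L _; rewrite (nhl_morph g_nhl); congr br.
  by apply/ffunP => k; rewrite !ffunE; case: ifP; rewrite ?lbijV_comm.
rewrite -[LHS]N_alpha /= IHi; congr (N (nb _ _)); apply/ffunP => k.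
by rewrite !ffunE lbijK lbijVK.
Qed.

Lemma deformedE lam x : deformed br nb lam x = \sum_(i < n) lam ^+ i *: nb i x.
Proof. by apply: eq_bigr => -[[|i] lt_i]. Qed.

Lemma deformed_skew_multilinear lam : skew_multilinear (deformed br nb lam).
Proof.
split=> [x k a u v|s x]; rewrite !deformedE.
  rewrite scaler_sumr -big_split; apply: eq_bigr => i _ /=.
  by rewrite nijenhuis_bracket_multilinear scalerDr !scalerA mulrC.
rewrite scaler_sumr; apply: eq_bigr => i _.
by rewrite nijenhuis_bracket_skew !scalerA mulrC.
Qed.

Lemma deformed_morph lam x :
  alpha (deformed br nb lam x) = deformed br nb lam (map_args alpha x).
Proof.
rewrite !deformedE linear_sum; apply: eq_bigr => i _.
by rewrite linearZ /= nijenhuis_bracket_morph.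
Qed.

(** * The pencil [alpha + lam N] as a morphism of brackets *)

Hypothesis n_gt0 : (0 < n)%N.
Hypothesis N_nij : forall x, br (map_args N x) = N (nb n.-1 x).

Lemma nijenhuis_pencil_morph lam x :
  let T := fun v => alpha v + lam *: N v in
  T (deformed br nb lam x) = br (map_args T x).
Proof.
have [br_lin _] := nhl_skew g_nhl.
(* [S i] is the coefficient of [lam ^+ i] in [br (map_args T x)]. *)
pose S i := \sum_(L : {set 'I_n} | #|L| == i)
  br [ffun k => if k \in L then N (x k) else alpha (x k)].
have S0 : S 0%N = alpha (br x).
  rewrite /S (big_pred1 set0) => [|L]; last by rewrite cards_eq0.
  rewrite (nhl_morph g_nhl); congr br.
  by apply/ffunP => k; rewrite !ffunE inE.
have Sn : S n = N (nb n.-1 x).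
  rewrite /S (big_pred1 setT) => [|L].
    by rewrite -N_nij; congr br; apply/ffunP => k; rewrite !ffunE inE.
  apply/eqP/eqP => [e|->]; last by rewrite cardsT card_ord.
  by apply/eqP; rewrite eqEcard subsetT cardsT card_ord e leqnn.
(* The recursion read at [map_args alpha x], where [alpha] cancels the inverses it contains. *)
have SS i : S i.+1 = alpha (nb i.+1 x) + N (nb i x).
  rewrite nijenhuis_bracket_morph /=.
  have -> : map_args alphaV (map_args alpha x) = x.
    by apply/ffunP => k; rewrite !ffunE lbijK.
  rewrite subrK; apply: eq_bigr => L _; congr br; apply/ffunP => k.
  by rewrite !ffunE lbijK.
move=> T; have -> : map_args T x =
    [ffun k => map_args alpha x k + lam *: map_args N x k].
  by apply/ffunP => k; rewrite !ffunE.
rewrite multilinear_expand // /T deformedE.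
transitivity (\sum_(i < n.+1) lam ^+ i *: S i); last first.
  apply: eq_bigr => i _; congr (_ *: _); apply: eq_bigr => L _; congr br.
  by apply/ffunP => k; rewrite !ffunE.
rewrite (pencil_sum (lbij alpha) N n (fun i => nb i x)).
apply: eq_bigr => -[i lt_in] _; congr (_ *: _) => /=.
(* Coefficients are compared in degree 0, in degrees 1 to [n.-1], and in degree [n], where only the
   [N] part remains and the Nijenhuis condition enters through [Sn]. *)
rewrite /pencil_coef; case: i lt_in => [|i] lt_in.
  by rewrite n_gt0 S0 addr0.
case: ltnP => [_|le_ni]; first by rewrite SS.
have iE : i = n.-1 by apply/eqP; rewrite -eqSS prednK // eqn_leq -ltnS lt_in.
by rewrite add0r iE prednK // Sn.
Qed.

(** * The fundamental identity for the deformed bracket *)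

Hypothesis charK : [pchar K] =i pred0.

Lemma deformed_fundamental lam : fundamental_identity alpha (deformed br nb lam).
Proof.
move=> x y; apply/eqP; rewrite -subr_eq0; apply/eqP; move: lam.
pose w := deformed br nb; pose ax : {ffun 'I_n.-1 -> V} := [ffun i => alpha (x i)].
(* [D lam] is the defect of the identity; [c i j] below collects its terms with outer bracket of
   index [i] and inner bracket of index [j]. *)
pose D lam := w lam (rcons_args ax (w lam y)) -
  \sum_(k < n) w lam (set_arg (map_args alpha y) k (w lam (rcons_args x (y k)))).
rewrite -/(forall lam, D lam = 0).
pose c i j := nb i (rcons_args ax (nb j y)) -
  \sum_(k < n) nb i (set_arg (map_args alpha y) k (nb j (rcons_args x (y k)))).
have DE lam : D lam = \sum_(i < n) \sum_(j < n) lam ^+ (i + j) *: c i j.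
  rewrite /D /w deformedE.
  under [X in _ - X]eq_bigr => k _ do rewrite deformedE.
  rewrite exchange_big -sumrB; apply: eq_bigr => i _ /=.
  have nb_lin := nijenhuis_bracket_multilinear i.
  rewrite deformedE multilinear_rcons_sum // scaler_sumr.
  under [X in _ - X]eq_bigr => k _.
    rewrite deformedE multilinear_sum // scaler_sumr; over.
  rewrite exchange_big -sumrB; apply: eq_bigr => j _ /=.
  rewrite /c scalerBr scaler_sumr scalerA -exprD; congr (_ - _).
  by apply: eq_bigr => k _; rewrite scalerA -exprD.
have [d dE] := sum_exp_double n n c.
have TD lam : alpha (D lam) + lam *: N (D lam) = 0.
  pose T v := alpha v + lam *: N v.
  have T_sub u v : T (u - v) = T u - T v.
    by rewrite /T !linearB addrACA -opprD.
  have T_sum (F : 'I_n -> V) : T (\sum_k F k) = \sum_k T (F k).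
    by rewrite /T !linear_sum -big_split.
  have Talpha v : T (alpha v) = alpha (T v).
    by rewrite /T linearD linearZ /= -[N (alpha v)]/((N \o alpha) v) N_alpha.
  have Tw z : T (w lam z) = br (map_args T z) := nijenhuis_pencil_morph lam z.
  rewrite -/(T (D lam)) T_sub Tw rcons_args_map Tw T_sum.
  (* Since [T] commutes with [alpha], the image of the defect is the defect of [br] at the arguments
     [T (x i)] and [T (y k)]. *)
  have -> : [ffun i => T (ax i)] = [ffun i => alpha ([ffun i => T (x i)] i)].
    by apply/ffunP => i; rewrite !ffunE Talpha.
  rewrite (nhl_fundamental g_nhl); apply/eqP; rewrite subr_eq0; apply/eqP.
  apply: eq_bigr => k _; rewrite Tw set_arg_map Tw rcons_args_map ffunE.
  by congr (br (set_arg _ _ _)); apply/ffunP => j; rewrite !ffunE Talpha.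
have d0 : forall k, (k < n + n)%N -> d k = 0.
  apply: (pencil_inj charK (f := lbij alpha) (g := N)).
    exact: can_inj (@lbijK _ _ alpha).
  by move=> lam; rewrite -dE -DE.
by move=> lam; rewrite DE dE big1 // => k _; rewrite d0 ?scaler0.
Qed.

End Nijenhuis.

Theorem theorem4p7 (K : closedFieldType) (charK : [pchar K] =i pred0)
    (V : lmodType K) (n : nat) (n_ge2 : (2 <= n)%N)
    (br : nary V n) (alpha : linear_bij V) (g_nhl : n_hom_lie br alpha)
    (N : {linear V -> V}) (N_nij : hom_nijenhuis br alpha N) :
  generates_deformation br alpha (nijenhuis_bracket br alpha N) /\
  trivial_deformation br alpha (nijenhuis_bracket br alpha N).
Proof.
have n_gt0 := ltnW n_ge2; case: N_nij => N_alpha N_nij.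
(* Triviality is witnessed by the operator [N] itself. *)
split; [split=> [i _|lam] | exists N => lam /=; split=> [v|x]].
- by split; [apply: nijenhuis_bracket_multilinear | apply: nijenhuis_bracket_skew].
- split; first exact: deformed_skew_multilinear.
    exact: deformed_morph.
  exact: deformed_fundamental.
- by rewrite /= linearD linearZ /= -[N (alpha v)]/((N \o alpha) v) N_alpha.
- exact: nijenhuis_pencil_morph.
Qed.
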